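(* The vector space $E$ is spanned by $\{\widehat{x}\mid x\in X\}$.
   Context: Let $\mathbb{F}_q$ be a finite field with $q$ elements, let $n,k$ be integers with $n>2k\geq 6$, and let $V$ be an $n$-dimensional vector space over $\mathbb{F}_q$. For $m\in\mathbb{Z}$ write $[m]=(q^m-1)/(q-1)$. Let $P$ be the set of all subspaces of $V$ and $P_\ell$ the set of $\ell$-dimensional subspaces; put $X=P_k$. Let $E$ be a (real) Euclidean space of dimension $[n]-1$ with inner product $\langle\,,\,\rangle$, and let $P_1\to E$, $s\mapsto\widehat{s}$ be a map such that: $E=\mathrm{Span}\{\widehat{s}\mid s\in P_1\}$; $\|\widehat{s}\|^2=[n]-1$ for $s\in P_1$; $\langle\widehat{s},\widehat{t}\rangle=-1$ for distinct $s,t\in P_1$; and $\sum_{s\in P_1}\widehat{s}=0$. For $u\in P$ define $\widehat{u}=\sum_{s\in P_1,\,s\subseteq u}\widehat{s}$. *)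

(* Defs.v *)
From HB Require Import structures.
From mathcomp Require Import all_boot all_order all_algebra.
From mathcomp Require Import sesquilinear reals.

Set Implicit Arguments.
Unset Strict Implicit.
Unset Printing Implicit Defensive.

Import Order.TTheory GRing.Theory Num.Theory.
Import VectorInternalTheory.
Local Open Scope ring_scope.

(* A vector space over a finite field has finitely many subspaces; this is
   needed for sums and enumerations over subspaces. *)
HB.instance Definition _ (F : finFieldType) (V : vectType F) :=
  [Countable of {vspace V} by <:].
HB.instance Definition _ (F : finFieldType) (V : vectType F) :=
  [Finite of {vspace V} by <:].

Definition qnum (R : realType) (q : nat) (m : int) : R :=
  (q%:R ^ m - 1) / (q%:R - 1).

Definition subspaces_of_dim (F : finFieldType) (V : vectType F) (l : nat) :=
  {u : {vspace V} | \dim u == l}.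

Notation "''P_' l ( V )" := (subspaces_of_dim V l)
  (at level 8, l at level 2, format "''P_' l ( V )") : type_scope.

Definition hat (R : realType) (F : finFieldType) (V : vectType F)
    (E : vectType R) (h : 'P_1(V) -> E) (u : {vspace V}) : E :=
  \sum_(s : 'P_1(V) | (val s <= u)%VS) h s.

(* Main.v *)
Require Import Defs.
From HB Require Import structures.
From mathcomp Require Import all_boot all_order all_algebra.
From mathcomp Require Import sesquilinear reals.

Set Implicit Arguments.
Unset Strict Implicit.
Unset Printing Implicit Defensive.

Import Order.TTheory GRing.Theory Num.Theory.
Local Open Scope ring_scope.

(** The vectors [hat x], for [x] of dimension [k], generate the vectors
    [hat w] for every lower positive dimension, hence the vectors [h s]
    themselves, which are the vectors [hat s] of the points [s].

    One goes down one dimension at a time. Let [w] be a proper subspace and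
    add up [hat y] over the [N] covers [y] of [w], i.e. the subspaces [y]
    containing [w] with one more dimension. A point [t] outside [w] lies in
    exactly one cover, namely [w + t], and a point of [w] lies in all [N] of
    them. Hence the total is the sum of all the [h t] plus [(N - 1) hat w]
    (lemma [sum_hat_covers]). The vectors [h t] add up to zero, and [N > 1] as
    soon as [w] has codimension at least two (lemma [card_covers_gt1]), so
    [hat w] is a linear combination of the [hat y]. This applies to every [w]
    of dimension less than [k], because [k < n]. *)

Definition covers (F : finFieldType) (V : vectType F) (w : {vspace V}) :
  {set {vspace V}} := [set y | (w <= y)%VS && (\dim y == (\dim w).+1)].

Lemma dim_add_point (F : fieldType) (V : vectType F) (w s : {vspace V}) :
  \dim s = 1 -> ~~ (s <= w)%VS -> \dim (w + s)%VS = (\dim w).+1.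
Proof.
move=> s1 sNw; rewrite dimv_disjoint_sum ?s1 ?addn1 //.
apply/eqP; rewrite -dimv_eq0 -leqn0 -ltnS ltnNge; apply: contra sNw => ge1.
have /eqP <- : (w :&: s == s)%VS by rewrite eqEdim capvSr s1.
exact: capvSl.
Qed.

Lemma covers_add_point (F : finFieldType) (V : vectType F)
    (w s : {vspace V}) :
  \dim s = 1 -> ~~ (s <= w)%VS -> (w + s)%VS \in covers w.
Proof. by move=> s1 sNw; rewrite inE addvSl dim_add_point /=. Qed.

Lemma covers_through_point (F : finFieldType) (V : vectType F)
    (w s y : {vspace V}) :
  \dim s = 1 -> ~~ (s <= w)%VS ->
  (y \in covers w) && (s <= y)%VS = (y == w + s)%VS.
Proof.
move=> s1 sNw; apply/andP/eqP => [[] | ->]; last first.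
  by rewrite covers_add_point ?addvSr.
rewrite inE => /andP[wy /eqP dimy] sy; apply/esym/eqP.
by rewrite eqEdim subv_add wy sy dimy dim_add_point /=.
Qed.

Lemma exists_point_notin (F : fieldType) (V : vectType F) (w : {vspace V}) :
  (\dim w < \dim {:V})%N -> exists2 s : {vspace V}, \dim s = 1 & ~~ (s <= w)%VS.
Proof.
move=> ltw; have /subvPn[v _ vNw] : ~~ (fullv <= w)%VS.
  by apply: contraL ltw => /dimvS; rewrite -leqNgt.
exists <[v]>%VS; last by rewrite -memvE.
by rewrite dim_vline; case: eqVneq vNw => // ->; rewrite mem0v.
Qed.

Lemma card_covers_gt1 (F : finFieldType) (V : vectType F) (w : {vspace V}) :
  ((\dim w).+1 < \dim {:V})%N -> (1 < #|covers w|)%N.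
Proof.
move=> ltw; have [s s1 sNw] := exists_point_notin (ltnW ltw).
have [t t1 tNy] : exists2 t : {vspace V}, \dim t = 1 & ~~ (t <= w + s)%VS.
  by apply: exists_point_notin; rewrite dim_add_point.
have tNw : ~~ (t <= w)%VS.
  by apply: contra tNy => tw; apply: subv_trans tw (addvSl _ _).
apply/card_gt1P; exists (w + s)%VS, (w + t)%VS.
split; rewrite ?covers_add_point //.
by apply: contraNneq tNy => ->; apply: addvSr.
Qed.

(** Double counting of the incidences between points and covers of [w]. The
    term [hat h w] on the left compensates for the points of [w], which occur
    once in the sum over all points. *)
Lemma sum_hat_covers (R : realType) (F : finFieldType) (V : vectType F)
    (E : vectType R) (h : 'P_1(V) -> E) (w : {vspace V}) :
  \sum_(y in covers w) hat h y + hat h w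
    = hat h w *+ #|covers w| + \sum_s h s.
Proof.
pose a (s : 'P_1(V)) := (val s <= w)%VS.
rewrite /hat (exchange_big_dep predT) //=.
rewrite (bigID a) /= [X in _ = _ + X](bigID a) /=.
have -> : \sum_(s | a s) \sum_(y in covers w | (val s <= y)%VS) h s
    = hat h w *+ #|covers w|.
  rewrite /hat -sumrMnl; apply: eq_bigr => s sw.
  rewrite -sumr_const; apply: eq_bigl => y; rewrite inE.
  by apply: andb_idr => /andP[/(subv_trans sw)].
have -> : \sum_(s | ~~ a s) \sum_(y in covers w | (val s <= y)%VS) h s
    = \sum_(s | ~~ a s) h s.
  apply: eq_bigr => s sNw; apply: big_pred1 => y.
  exact: covers_through_point (eqP (valP s)) sNw.
by rewrite -!addrA [X in _ + X]addrC.
Qed.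

Lemma hat_point (R : realType) (F : finFieldType) (V : vectType F)
    (E : vectType R) (h : 'P_1(V) -> E) (s : 'P_1(V)) : hat h (val s) = h s.
Proof.
rewrite /hat (big_pred1 s) // => t.
by rewrite /= -val_eqE /= eqEdim (eqP (valP s)) (eqP (valP t)) andbT.
Qed.

Lemma hat_mem_of_covers (R : realType) (F : finFieldType) (V : vectType F)
    (E : vectType R) (h : 'P_1(V) -> E) (S : {vspace E}) (w : {vspace V}) :
  \sum_s h s = 0 -> ((\dim w).+1 < \dim {:V})%N ->
  (forall y, y \in covers w -> hat h y \in S) -> hat h w \in S.
Proof.
move=> h0 /card_covers_gt1 gt1 hS; have := sum_hat_covers h w.
rewrite h0 addr0; case: #|_| gt1 => // N N0.
rewrite mulrSr => /addIr sumE.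
have : hat h w *+ N \in S by rewrite -sumE; apply: memv_suml.
by rewrite -scaler_nat rpredZeq pnatr_eq0 -leqn0 leqNgt -ltnS N0.
Qed.

Theorem lemma6p7 (R : realType) (F : finFieldType) (V : vectType F)
    (n k : nat) (hk : (6 <= 2 * k)%N) (hn : (2 * k < n)%N)
    (dimV : \dim {:V} = n)
    (E : vectType R) (ip : {dot E for idfun})
    (dimE : (\dim {:E})%:R = qnum R #|F| n - 1)
    (h : 'P_1(V) -> E)
    (h_span : <<[seq h s | s : 'P_1(V)]>>%VS = {:E}%VS)
    (h_norm : forall s : 'P_1(V), ip (h s) (h s) = qnum R #|F| n - 1)
    (h_dot : forall s t : 'P_1(V), s != t -> ip (h s) (h t) = -1)
    (h_sum : \sum_(s : 'P_1(V)) h s = 0) :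
  <<[seq hat h (val x) | x : 'P_k(V)]>>%VS = {:E}%VS.
Proof.
have k0 : (0 < k)%N by case: k hk {hn}.
have ltkn : (k < n)%N by apply: leq_ltn_trans hn; rewrite leq_pmull.
set S := <<_>>%VS.
(* Downward induction on the dimension, written as upward induction on the
   defect [d] with respect to [k]. *)
have hatS d : forall w : {vspace V}, (\dim w + d)%N = k -> hat h w \in S.
  elim: d => [|d IHd] w dimw.
    have dimwk : \dim w == k by rewrite -dimw addn0.
    by apply/memv_span/mapP; exists (Sub w dimwk); rewrite ?mem_enum.
  apply: hat_mem_of_covers => // [|y].
    by rewrite dimV; apply: leq_ltn_trans ltkn; rewrite -dimw addnS ltnS leq_addr.
  by rewrite inE => /andP[_ /eqP dimy]; apply: IHd; rewrite dimy addSnnS.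
apply/eqP; rewrite eqEsubv subvf -h_span /=; apply/span_subvP => _ /mapP[s _ ->].
by rewrite -hat_point (hatS k.-1) // (eqP (valP s)) add1n prednK.
Qed.
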